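(* Let $X$ be an $n$-dimensional smooth manifold with Riemannian metric $g$, let $f:X\to\mathbb{R}$ be a Morse function, and let $p$ be a critical point of $f$ of Morse index $k$. Then there exists a local coordinate system $(x_1,\dots,x_n)$ on a neighbourhood $U$ of $p$, in which $p$ corresponds to $\mathbf{0}$, such that $$\nabla f(\mathbf{x})=\sum_{i=1}^n\left(\lambda_i x_i+O(\|\mathbf{x}\|^2)\right)\frac{\partial}{\partial x_i},$$ where $\lambda_1,\dots,\lambda_k<0$ and $\lambda_{k+1},\dots,\lambda_n>0$. Furthermore, the set of eigenvalues $\{\lambda_1,\dots,\lambda_n\}$ is independent of the choice of coordinates (i.e. any two such coordinate systems centred at $p$ in which $\nabla f$ has a diagonal linear part yield the same set $\{\lambda_1,\dots,\lambda_n\}$).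
   Context: A Morse function is a smooth function all of whose critical points are non-degenerate (the Hessian at the critical point has full rank). The gradient $\nabla f$ is taken with respect to $g$. The Morse index of $p$ is the number of negative eigenvalues of the Hessian of $f$ at $p$. *)

(* Defs.v *)
From HB Require Import structures.
From mathcomp Require Import all_boot all_order all_algebra.
From mathcomp Require Import all_classical all_reals all_analysis.

Set Implicit Arguments.
Unset Strict Implicit.
Unset Printing Implicit Defensive.

Import Order.TTheory GRing.Theory Num.Theory.
Import numFieldNormedType.Exports.

Local Open Scope classical_set_scope.
Local Open Scope ring_scope.

(* Points of R^n and coordinate expressions of tangent vectors are row
   vectors.  Accordingly, as for the library's Jacobian ['J f x], the
   differential of f at x sends v to [v *m 'J f x]. *)

Section Calculus.
Context {R : realType} {n : nat}.

Definition partial {V : normedModType R} (i : 'I_n) (h : 'rV[R]_n -> V)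
  : 'rV[R]_n -> V := fun x => 'D_(delta_mx 0 i) h x.

(* Class C^k on an open set: C^0 is continuity, and C^(k+1) is Frechet
   differentiability with all partial derivatives of class C^k. *)
Fixpoint C_on {V : normedModType R} (k : nat) (U : set 'rV[R]_n)
    (h : 'rV[R]_n -> V) : Prop :=
  match k with
  | 0 => {within U, continuous h}
  | k'.+1 => (forall x, U x -> differentiable h x) /\
             (forall i, C_on k' U (partial i h))
  end.

Definition smooth_on {V : normedModType R} (U : set 'rV[R]_n)
  (h : 'rV[R]_n -> V) : Prop := forall k, C_on k U h.

End Calculus.

(* A chart is a homeomorphism from the open set [dom] onto the open subset
   [coords @` dom] of R^n, with inverse [param].  The values of [coords] outside
   [dom] and of [param] outside [coords @` dom] are irrelevant. *)
Record chart (R : realType) (n : nat) (X : topologicalType) := Chart {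
  dom : set X;
  coords : X -> 'rV[R]_n;
  param : 'rV[R]_n -> X;
  dom_open : open dom;
  image_open : open (coords @` dom);
  coordsK : forall p, dom p -> param (coords p) = p;
  coords_continuous : {within dom, continuous coords};
  param_continuous : {within coords @` dom, continuous param} }.

Section Charts.
Context {R : realType} {n : nat} {X : topologicalType}.
Implicit Types c d : chart R n X.

Definition coords_image c : set 'rV[R]_n := coords c @` dom c.

Definition transition c d : 'rV[R]_n -> 'rV[R]_n := coords d \o param c.

Definition compatible c d : Prop :=
  smooth_on (coords c @` (dom c `&` dom d)) (transition c d) /\
  smooth_on (coords d @` (dom c `&` dom d)) (transition d c).

End Charts.

Record smooth_manifold (R : realType) (n : nat) := SmoothManifold {
  carrier :> topologicalType;
  manifold_hausdorff : hausdorff_space carrier;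
  manifold_countable : @second_countable carrier;
  atlas : set (chart R n carrier);
  atlas_cover : forall p, exists2 c, atlas c & dom c p;
  atlas_compatible : forall c d, atlas c -> atlas d -> compatible c d;
  atlas_maximal : forall c, (forall d, atlas d -> compatible c d) -> atlas c }.

Arguments atlas {R n} s.

Definition coordinates_at (R : realType) (n : nat) (X : smooth_manifold R n)
  (p : X) : set (chart R n X) := [set c | atlas X c /\ dom c p].

(* A Riemannian metric, as a symmetric positive definite covariant 2-tensor:
   [gram c x] is its Gram matrix in the coordinates c at the point of
   coordinates x, so that <v, w> = v *m gram c x *m w^T, and [gram_change] is
   the transformation law of covariant 2-tensors. *)
Record riemannian_metric (R : realType) (n : nat) (X : smooth_manifold R n) :=
  RiemannianMetric {
  gram :> chart R n X -> 'rV[R]_n -> 'M[R]_n;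
  gram_smooth : forall c i j, atlas X c ->
    smooth_on (coords_image c) (fun x => gram c x i j);
  gram_sym : forall c x, atlas X c -> coords_image c x ->
    (gram c x)^T = gram c x;
  gram_pos : forall c x (v : 'rV[R]_n), atlas X c -> coords_image c x -> v != 0 ->
    0 < (v *m gram c x *m v^T) 0 0;
  gram_change : forall c d p, atlas X c -> atlas X d -> dom c p -> dom d p ->
    gram c (coords c p) = 'J (transition c d) (coords c p)
      *m gram d (coords d p) *m ('J (transition c d) (coords c p))^T }.

Section Functions.
Context {R : realType} {n : nat} {X : smooth_manifold R n}.
Implicit Types (f : X -> R) (c : chart R n X) (p : X) (x : 'rV[R]_n).

Definition local_expr f c : 'rV[R]_n -> R := f \o param c.

Definition smooth_function f : Prop :=
  forall c, atlas X c -> smooth_on (coords_image c) (local_expr f c).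

Definition differential f c x : 'rV[R]_n :=
  \row_i partial i (local_expr f c) x.

Definition hessian f c x : 'M[R]_n :=
  \matrix_(i, j) partial i (partial j (local_expr f c)) x.

(* In the next definitions the choice of coordinates is immaterial: differentials
   transform by the chain rule and, at a critical point, the Hessian matrices
   in two coordinate systems are congruent. *)
Definition critical_point f p : Prop :=
  exists2 c, coordinates_at p c & differential f c (coords c p) = 0.

Definition nondegenerate f p : Prop :=
  exists2 c, coordinates_at p c & \rank (hessian f c (coords c p)) = n.

(* Negative eigenvalues are counted with (algebraic) multiplicity. *)
Definition negative_eigenvalues (H : 'M[R]_n) : nat :=
  \big[addn/0%N]_(a \in [set a : R | eigenvalue H a /\ a < 0])
    mup a (char_poly H).

Definition morse_index f p (k : nat) : Prop :=
  exists2 c, coordinates_at p c &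
    negative_eigenvalues (hessian f c (coords c p)) = k.

Definition morse_function f : Prop :=
  smooth_function f /\ forall p, critical_point f p -> nondegenerate f p.

(* The components of grad f in the coordinates c, that is the row (g^{ij} d_j f);
   [gradientP] is the coordinate-free characterization <grad f, w> = df(w). *)
Definition gradient (g : riemannian_metric X) f c x : 'rV[R]_n :=
  differential f c x *m invmx (g c x).

Lemma gram_unit (g : riemannian_metric X) c x :
  atlas X c -> coords_image c x -> g c x \in unitmx.
Proof.
move=> Ac cx; rewrite -row_free_unit -kermx_eq0; apply/eqP/row_matrixP => i.
rewrite row0; apply/eqP/negPn/negP => /(gram_pos g Ac cx).
by rewrite -row_mul mulmx_ker row0 mul0mx mxE ltxx.
Qed.

Lemma gradientP (g : riemannian_metric X) f c x : atlas X c -> coords_image c x ->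
  differentiable (local_expr f c) x -> forall v : 'rV[R]_n,
  v = gradient g f c x <->
  forall w : 'rV[R]_n, (v *m g c x *m w^T) 0 0 = 'd (local_expr f c) x w.
Proof.
move=> Ac cx df v; have gU := gram_unit g Ac cx.
have dE (w : 'rV[R]_n) :
    (differential f c x *m w^T) 0 0 = 'd (local_expr f c) x w.
  rewrite [in RHS](row_sum_delta w) linear_sum mxE; apply: eq_bigr => i _.
  by rewrite linearZ !mxE /partial deriveE// mulrC.
split=> [-> w|vE]; first by rewrite /gradient mulmxKV.
rewrite /gradient; apply: (canRL (mulmxK gU)); apply/rowP => i.
have := vE (delta_mx 0 i); rewrite -dE trmx_delta -!colE.
by rewrite [LHS]mxE [RHS]mxE.
Qed.

(* c is a coordinate system centred at p in which grad f has the diagonal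
   linear part diag(l_1, ..., l_n). *)
Definition diagonal_linear_part (g : riemannian_metric X) f p c
    (l : 'I_n -> R) : Prop :=
  [/\ coordinates_at p c, coords c p = 0 &
    forall i, (fun x : 'rV[R]_n => gradient g f c x 0 i)
      = (fun x : 'rV[R]_n => l i * x 0 i)
        +O_ (nbhs (0 : 'rV[R]_n)) (fun x : 'rV[R]_n => `|x| ^+ 2)].

End Functions.

(* Main.v *)
(* At a critical point with Hessian H and Gram matrix G the gradient has the
   linear part x |-> x H G^-1, and a change of coordinates with Jacobian J
   replaces (H, G) by (J^-1 H J^-T, J^-1 G J^-T), hence conjugates H G^-1 by J.
   This determines the diagonal of any diagonal linear part.  Conversely H G^-1
   is self-adjoint for the inner product G, hence diagonalizable over the reals,
   and a linear change of coordinates realizes an eigenbasis.  By the law of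
   inertia H has as many negative eigenvalues as H G^-1. *)
From mathcomp Require Import fingroup perm complex.
Require Import Defs.
From mathcomp Require Import all_boot all_order all_algebra.
From mathcomp Require Import all_classical all_reals all_analysis.
From mathcomp Require Import ring lra.

Set Implicit Arguments.
Unset Strict Implicit.
Unset Printing Implicit Defensive.

Import Order.TTheory GRing.Theory Num.Theory.
Import numFieldNormedType.Exports.

Local Open Scope classical_set_scope.
Local Open Scope ring_scope.

(** * Simultaneous diagonalization and the law of inertia *)

(** Real diagonalizability is read off from the minimal polynomial: it has no factor (X - a)^2 +
    b^2, where b = 0 is allowed, so its roots are real and simple. The eigenvectors obtained in this
    way need not be orthogonal for G, which is why the sign of H on their spans takes an argument of
    its own. The Morse index is defined by the eigenvalues of H alone, that is, by the case G = 1 of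
    H G^-1; inertia is therefore a comparison of two inner products for the same H, and
    nondegeneracy excludes the eigenvalue 0. Symmetry of H, on which self-adjointness rests, is the
    equality of mixed partial derivatives and comes from second differences. The remainder O(|x|^2)
    combines a second order Taylor bound for df with a Lipschitz bound for G(x) at the critical
    point. *)

Lemma real_roots_simple_split (R : rcfType) (p : {poly R}) : p \is monic ->
  (forall a b q, p != q * (('X - a%:P) ^+ 2 + (b ^+ 2)%:P)) ->
  exists2 s, uniq s & p = \prod_(a <- s) ('X - a%:P).
Proof.
move=> p_monic p_noquad.
pose toC := map_poly (real_complex R).
have [s psE] := closed_field_poly_normal (toC p).
have {}psE : toC p = \prod_(z <- s) ('X - z%:P).
  by rewrite psE /toC lead_coef_map (monicP p_monic) rmorph1 scale1r.
have sR z : z \in s -> z = (complex.Re z)%:C%C.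
  case: z => a b zs; apply/eqP; rewrite eq_complex /= eqxx /=.
  apply/contraT => b_neq0.
  set q : {poly R} := ('X - a%:P) ^+ 2 + (b ^+ 2)%:P.
  have qE : toC q = ('X - (a +i* b)%C%:P) * ('X - (a -i* b)%C%:P).
    rewrite /toC /q rmorphD rmorphXn /= rmorphB /= map_polyX !map_polyC /=.
    rewrite (_ : (b ^+ 2)%:C%C = - ((0 +i* b)%C ^+ 2)); last first.
      by apply/eqP; rewrite eq_complex /= expr2 /=; apply/andP; split; apply/eqP; ring.
    rewrite (_ : (a +i* b)%C = a%:C%C + (0 +i* b)%C); last first.
      by apply/eqP; rewrite eq_complex /= addr0 add0r !eqxx.
    rewrite (_ : (a -i* b)%C = a%:C%C - (0 +i* b)%C); last first.
      by apply/eqP; rewrite eq_complex /= oppr0 addr0 add0r !eqxx.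
    by rewrite polyCB polyCD polyCN !rmorphXn /=; ring.
  have root1 : root (toC p) (a +i* b)%C by rewrite psE root_prod_XsubC.
  have root2 : root (toC p) (a -i* b)%C.
    rewrite -[(a -i* b)%C]/((a +i* b)^*)%C -complex_root_conj.
    suff -> : map_poly (@conjc R) (toC p) = toC p by [].
    by apply/polyP => i; rewrite !coef_map /= oppr0.
  have : toC q %| toC p.
    (* Since b is nonzero, the two conjugate roots are distinct and their linear factors coprime, so
       the product divides p over the complex numbers, hence already over R. *)
    rewrite qE Gauss_dvdp ?dvdp_XsubCl ?root1 ?root2//.
    apply: coprimep_XsubC2; apply: contra b_neq0 => /eqP/subr0_eq[] /eqP.
    by rewrite eqNr.
  rewrite dvdp_map => /dvdpP[r pE].
  by have := p_noquad a b r; rewrite -pE eqxx.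
have pE : p = \prod_(a <- map (@complex.Re R) s) ('X - a%:P).
  apply: (map_poly_inj (real_complex R)); rewrite [LHS]psE rmorph_prod big_map.
  by apply: eq_big_seq => z /sR {1}->; rewrite /= map_polyXsubC.
set t := map _ s in pE.
exists t => //.
apply: count_mem_uniq => a.
case: (boolP (a \in t)) => [a_t|/count_memPn//].
have := perm_to_rem a_t => /[dup] /seq.permP/(_ (pred1 a)) ->.
rewrite /= eqxx.
have [/[dup] a_t2 /perm_to_rem tE2|/count_memPn -> //] := boolP (a \in rem a t).
(* The case b = 0 of the excluded factor rules out a double root a. *)
move=> tE; have := p_noquad a 0 (\prod_(c <- rem a (rem a t)) ('X - c%:P)).
rewrite pE (perm_big _ tE)/= big_cons (perm_big _ tE2) /= big_cons.
by rewrite expr0n addr0 mulrA -expr2 mulrC eqxx.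
Qed.

Definition posdef_mx (R : numDomainType) n (G : 'M[R]_n) : Prop :=
  forall v : 'rV[R]_n, v != 0 -> 0 < (v *m G *m v^T) 0 0.

Lemma posdef_mx_ge0 (R : numDomainType) n (G : 'M[R]_n) (v : 'rV[R]_n) :
  posdef_mx G -> 0 <= (v *m G *m v^T) 0 0.
Proof.
have [->|/[swap] Gp /Gp /ltW//] := eqVneq v 0.
by rewrite !mul0mx mxE.
Qed.

Lemma posdef_mx_unit (R : numFieldType) n (G : 'M[R]_n) : posdef_mx G -> G \in unitmx.
Proof.
move=> Gp; rewrite -row_free_unit -kermx_eq0; apply/eqP/row_matrixP => i.
rewrite row0; apply/eqP/negPn/negP => /Gp.
by rewrite -row_mul mulmx_ker row0 mul0mx mxE ltxx.
Qed.

(* If (X - a)^2 + b^2 divides the minimal polynomial, replacing this factor by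
   X - a still gives a polynomial that annihilates M: for N := M - a, a row u
   with u N^2 + b^2 u = 0 satisfies |u N|^2 + b^2 |u|^2 = 0. *)
Lemma selfadjoint_diagonalizable (R : rcfType) n (G M : 'M[R]_n) :
  G^T = G -> posdef_mx G -> (M *m G)^T = M *m G -> diagonalizable M.
Proof.
case: n G M => [|n] G M GT Gp MGT.
  (* Size 0 is set apart because evaluating polynomials at M uses the ring of matrices of size
     [n.+1]. *)
  by exists 1%:M; rewrite ?unitmx1// [M]flatmx0; apply/is_diag_mxP => -[].
have sadj a : ((M - a%:M) *m G)^T = (M - a%:M) *m G.
  by rewrite mulmxBl linearB /= MGT mul_scalar_mx linearZ/= GT.
have kerQ a b (B : 'M[R]_n.+1) :
    B *m ((M - a%:M) *m (M - a%:M)) + b ^+ 2 *: B = 0 -> B *m (M - a%:M) = 0.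
  set N := M - a%:M => BE; have NG : N *m G = G *m N^T.
    by rewrite -[LHS]sadj trmx_mul GT.
  apply/row_matrixP => i; rewrite row0; apply/eqP/negPn/negP.
  rewrite row_mul => /Gp; apply/negP; rewrite -leNgt.
  have := congr1 (row i) BE; rewrite linearD linearZ /= !row_mul row0.
  set u := row i B => uE.
  have -> : (u *m N *m G *m (u *m N)^T) 0 0 = - (b ^+ 2 * (u *m G *m u^T) 0 0).
    rewrite trmx_mul !mulmxA -(mulmxA (u *m N) G) -NG !mulmxA -(mulmxA u N N).
    have -> : u *m (N *m N) = - (b ^+ 2 *: u) by apply/eqP; rewrite -addr_eq0 uE.
    by rewrite !mulNmx -!scalemxAl mxE [in LHS]mxE.
  by rewrite oppr_le0 mulr_ge0 ?sqr_ge0// posdef_mx_ge0.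
apply/diagonalizableP.
have [|s s_uniq sE] := real_roots_simple_split (mxminpoly_monic M); last first.
  by exists s => //; rewrite sE.
move=> a b q; apply/eqP => pE.
have qM : horner_mx M (q * ('X - a%:P)) = 0.
  rewrite rmorphM rmorphB /= horner_mx_X horner_mx_C; apply: (kerQ a b).
  rewrite -mul_mx_scalar -mulmxDr.
  have := mx_root_minpoly M; rewrite pE rmorphM rmorphD rmorphXn rmorphB /=.
  by rewrite horner_mx_X !horner_mx_C expr2 !mulmxE.
have p0 : mxminpoly M != 0 by rewrite monic_neq0// mxminpoly_monic.
have q0 : q != 0 by apply: contra_neq p0 => q0; rewrite pE q0 mul0r.
have := dvdp_leq _ (mxminpoly_min qM).
rewrite mulf_eq0 negb_or q0 polyXsubC_eq0 => /(_ isT).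
rewrite size_mul ?polyXsubC_eq0// size_XsubC addn2 /=.
rewrite pE size_mul//; last first.
  by apply: contra_neq p0 => q2; rewrite pE q2 mulr0.
rewrite size_polyDl; last first.
  by rewrite size_exp_XsubC (leq_ltn_trans (size_polyC_leq1 _)).
by rewrite size_exp_XsubC addn3 /= ltnn.
Qed.

Lemma row_diag_mul (R : comPzRingType) m n (d : 'rV[R]_m) (A : 'M[R]_(m, n)) i :
  row i (diag_mx d *m A) = d 0 i *: row i A.
Proof. by rewrite row_mul row_diag_mx -scalemxAl -rowE. Qed.

(** The conclusion only separates the eigenvalues by sign, so a partition of the indices into
    negative ones and others takes the place of a sort; [k] is the size of the first block. *)
Lemma sort_negative (R : numDomainType) n (d : 'I_n -> R) :
  exists k (s : 'S_n), [/\ (k <= n)%N, forall i : 'I_n, (i < k)%N -> d (s i) < 0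
    & forall i : 'I_n, (k <= i)%N -> ~~ (d (s i) < 0)].
Proof.
pose neg := [pred i | d i < 0].
pose t := seq.filter neg (enum 'I_n) ++ seq.filter (predC neg) (enum 'I_n).
have pt : perm_eq t (ord_tuple n) by rewrite val_ord_tuple; apply/permPl/perm_filterC.
have st : size t == n by rewrite (perm_size pt) size_tuple.
have /tuple_permP[s sE] : perm_eq (Tuple st) (ord_tuple n) by [].
exists (size (seq.filter neg (enum 'I_n))), s.
have sn (i : 'I_n) : s i = nth i t i.
  by rewrite (sE : t = _) -tnth_nth tnth_mktuple tnth_ord_tuple.
split=> [|i ik|i ki].
- by rewrite -[leqRHS](eqP st) size_cat leq_addr.
- rewrite sn nth_cat ik.
  by have := mem_nth i ik; rewrite mem_filter => /andP[].
- rewrite sn nth_cat ltnNge ki /=.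
  set j := (_ - _)%N.
  have jt : (j < size (seq.filter (predC neg) (enum 'I_n)))%N.
    by rewrite ltn_subLR// -size_cat -/t (eqP st).
  by have := mem_nth i jt; rewrite mem_filter => /andP[].
Qed.

(** The rows of [P] are eigenvectors of H G^-1 with eigenvalues [d]. Writing this as P H = D P G
    avoids the inverse of G and makes G = 1 the ordinary eigenvalue problem for H. *)
Lemma simultaneous_diag (R : rcfType) n (G H : 'M[R]_n) :
  G^T = G -> posdef_mx G -> H^T = H ->
  exists k P d, [/\ (k <= n)%N, P \in unitmx, P *m H = diag_mx d *m P *m G,
    forall i : 'I_n, (i < k)%N -> d 0 i < 0 & forall i : 'I_n, (k <= i)%N -> 0 <= d 0 i].
Proof.
move=> GT Gp HT; have Gu := posdef_mx_unit Gp.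
have [|P Pu] := @selfadjoint_diagonalizable R n G (H *m invmx G) GT Gp.
  by rewrite mulmxKV.
move=> /diagonalizable_forPex[d /(simmxP Pu) PE].
have {}PE : P *m H = diag_mx d *m P *m G by rewrite -PE -!mulmxA mulVmx ?mulmx1.
have [k [s [kn ltk gek]]] := sort_negative (d 0).
exists k, (row_perm s P), (col_perm s d); split=> //.
- by rewrite row_permE unitmx_mul unitmx_perm.
- apply/row_matrixP => i; rewrite -mulmxA row_diag_mul !row_mul mxE.
  have -> : row i (row_perm s P) = row (s i) P by apply/rowP => j; rewrite !mxE.
  by rewrite -row_mul PE -mulmxA row_diag_mul row_mul.
- by move=> i /ltk; rewrite mxE.
- by move=> i /gek; rewrite mxE -leNgt.
Qed.

(* K := P G P^T commutes with diag(d), so that K i j = 0 unless d i = d j; hence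
   e d i K i j = s i K i j s j on the support of u, where s i := sqrt (e d i). *)
Lemma simdiag_form_sign (R : rcfType) n (G H P : 'M[R]_n) (d u : 'rV[R]_n) (e : R) :
  G^T = G -> posdef_mx G -> H^T = H -> P \in unitmx ->
  P *m H = diag_mx d *m P *m G -> (forall i, u 0 i != 0 -> 0 < e * d 0 i) ->
  u != 0 -> 0 < e * (u *m P *m H *m (u *m P)^T) 0 0.
Proof.
move=> GT Gp HT Pu PE ud u0.
pose K := P *m G *m P^T.
have DK : P *m H *m P^T = diag_mx d *m K by rewrite PE !mulmxA.
have KT : K^T = K by rewrite /K !trmx_mul trmxK GT mulmxA.
have DKT : diag_mx d *m K = K *m diag_mx d.
  rewrite -DK -[RHS]trmxK trmx_mul tr_diag_mx KT -DK !trmx_mul trmxK HT.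
  by rewrite mulmxA.
have DKij i j : d 0 i * K i j = K i j * d 0 j.
  by have /matrixP/(_ i j) := DKT; rewrite mul_diag_mx mul_mx_diag !mxE.
pose s i := Num.sqrt (e * d 0 i).
pose w := \row_i (u 0 i * s i) : 'rV[R]_n.
have w0 : w *m P != 0.
  apply: contra_neq u0 => wP.
  have : w = 0 by rewrite -(mulmxK Pu w) wP mul0mx.
  move=> /rowP wE; apply/rowP => i; rewrite [RHS]mxE; apply/eqP/negPn/negP => ui.
  have := wE i; rewrite !mxE => /eqP; rewrite mulf_eq0 (negbTE ui) /=.
  by rewrite sqrtr_eq0 leNgt ud.
suff -> : e * (u *m P *m H *m (u *m P)^T) 0 0 = (w *m P *m G *m (w *m P)^T) 0 0.
  exact: Gp.
have -> : u *m P *m H *m (u *m P)^T = u *m (diag_mx d *m K) *m u^T.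
  by rewrite -DK trmx_mul !mulmxA.
have -> : w *m P *m G *m (w *m P)^T = w *m K *m w^T.
  by rewrite trmx_mul /K !mulmxA.
clearbody K; rewrite !mxE mulr_sumr.
apply: eq_bigr => j _; rewrite !mxE !mulr_suml mulr_sumr.
apply: eq_bigr => i _; rewrite mul_diag_mx !mxE.
have [->|ui] := eqVneq (u 0 i) 0; first by rewrite !mul0r mulr0.
have [->|uj] := eqVneq (u 0 j) 0; first by rewrite !(mul0r, mulr0).
have [K0|K0] := eqVneq (K i j) 0; first by rewrite K0 !(mul0r, mulr0).
have dij : d 0 i = d 0 j by apply: (mulfI K0); rewrite -DKij mulrC.
have : s i * s j = e * d 0 i.
  by rewrite /s -dij -expr2 sqr_sqrtr// ltW// ud.
move=> sij; rewrite [LHS](_ : _ = u 0 i * u 0 j * K i j * (e * d 0 i)); last by ring.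
by rewrite -sij; ring.
Qed.

(* The form H is negative on the span of the first k1 rows of P1, and positive on
   the span of the last n - k2 rows of P2. *)
Lemma inertia_le (R : rcfType) n (G1 G2 H P1 P2 : 'M[R]_n) (d1 d2 : 'rV[R]_n) k1 k2 :
  G1^T = G1 -> posdef_mx G1 -> G2^T = G2 -> posdef_mx G2 -> H^T = H ->
  P1 \in unitmx -> P2 \in unitmx ->
  P1 *m H = diag_mx d1 *m P1 *m G1 -> P2 *m H = diag_mx d2 *m P2 *m G2 ->
  (k1 <= n)%N -> (k2 <= n)%N ->
  (forall i : 'I_n, (i < k1)%N -> d1 0 i < 0) ->
  (forall i : 'I_n, (k2 <= i)%N -> 0 < d2 0 i) ->
  (k1 <= k2)%N.
Proof.
move=> G1T G1p G2T G2p HT P1u P2u P1E P2E k1n k2n d1n d2p.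
pose A : 'M[R]_n := pid_mx k1 *m P1; pose B := copid_mx k2 *m P2.
(* If the two spans meet only in 0, then k1 + (n - k2) <= n. Otherwise a common nonzero vector gives
   H both signs. *)
have [/eqP A0|] := boolP ((A :&: B)%MS == 0).
  have := mxrank_sum_cap A B.
  rewrite A0 mxrank0 addn0 !mxrankMfree ?row_free_unit// rank_pid_mx// rank_copid_mx//.
  have := rank_leq_col (A + B)%MS.
  move=> /[swap] -> h.
  by move: (leq_add h (leqnn k2)); rewrite -addnA subnK// addnC leq_add2l.
case/rowV0Pn => v; rewrite sub_capmx => /andP[/submxP[u1 vE1] /submxP[u2 vE2]] v0.
rewrite mulmxA in vE1; rewrite mulmxA in vE2.
set w1 := u1 *m _ in vE1; set w2 := u2 *m _ in vE2.
have w10 : w1 != 0 by apply: contra_neq v0 => w0; rewrite vE1 w0 mul0mx.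
have w20 : w2 != 0 by apply: contra_neq v0 => w0; rewrite vE2 w0 mul0mx.
have h1 : 0 < -1 * (v *m H *m v^T) 0 0.
  rewrite vE1; apply: (simdiag_form_sign G1T G1p HT P1u P1E) => // i w1i.
  rewrite mulN1r oppr_gt0 d1n//; apply: contraNT w1i; rewrite -leqNgt => k1i.
  rewrite mxE big1// => j _; rewrite mxE.
  by case: eqVneq => [->|]; rewrite ?ltnNge ?k1i ?mulr0.
have h2 : 0 < 1 * (v *m H *m v^T) 0 0.
  rewrite vE2; apply: (simdiag_form_sign G2T G2p HT P2u P2E) => // i w2i.
  rewrite mul1r d2p// leqNgt; apply: contraNN w2i => ik2.
  rewrite mxE big1// => j _; rewrite !mxE.
  case: (eqVneq j i) => [->|ji]; first by rewrite eqxx ik2 subrr mulr0.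
  by move: ji; rewrite -val_eqE => /negbTE ->; rewrite subrr mulr0.
by move: h1 h2; rewrite mulN1r mul1r oppr_gt0 => /lt_trans h /h; rewrite ltxx.
Qed.

(** Both characteristic polynomials are multiplied by det P, a nonzero constant, and the products
    compared; no inverse over the polynomial ring is formed. *)
Lemma char_poly_simdiag (F : fieldType) n (A P : 'M[F]_n) (d : 'rV[F]_n) :
  P \in unitmx -> P *m A = diag_mx d *m P ->
  char_poly A = \prod_(i < n) ('X - (d 0 i)%:P).
Proof.
move=> Pu PA; transitivity (char_poly (diag_mx d)); last first.
  rewrite char_poly_trig ?diag_mx_is_trig//.
  by apply: eq_bigr => i _; rewrite mxE eqxx.
have detP : \det (map_mx polyC P) != 0.
  by rewrite det_map_mx polyC_eq0 -unitfE -unitmxE.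
apply: (mulfI detP); rewrite /char_poly [RHS]mulrC -!det_mulmx; congr (\det _).
rewrite [LHS]mulmxBr [RHS]mulmxBl -!map_mxM PA.
by rewrite mul_mx_scalar mul_scalar_mx.
Qed.

Lemma negative_eigenvalues_simdiag (R : realType) n (H P : 'M[R]_n)
    (d : 'rV[R]_n) :
  P \in unitmx -> P *m H = diag_mx d *m P ->
  negative_eigenvalues H = #|[set i | d 0 i < 0]%SET|.
Proof.
move=> Pu PH; have cE := char_poly_simdiag Pu PH.
pose s := [seq d 0 i | i <- enum 'I_n].
have csE : char_poly H = \prod_(a <- s) ('X - a%:P).
  by rewrite cE big_map big_enum.
pose r := undup [seq a <- s | a < 0].
(* [r] lists the negative roots without repetition. Over this finite list the sum of multiplicities
   can be exchanged with the sum over indices, and each i with d i < 0 counts once, at the value d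
   i. *)
rewrite /negative_eigenvalues (@fsbig_fwiden _ _ _ _ r); first last.
- move=> a [/= ar]; rewrite csE mu_prod_XsubC => hn; exfalso; apply: hn.
  move: ar; rewrite mem_undup mem_filter => /andP[a0 as_]; split=> //.
  by rewrite eigenvalue_root_char csE root_prod_XsubC.
- exact: undup_uniq.
- move=> a [/=]; rewrite eigenvalue_root_char csE root_prod_XsubC => as_ a0.
  by rewrite mem_undup mem_filter a0.
rewrite csE; under eq_bigr do rewrite mu_prod_XsubC -sum1_count big_mkcond.
rewrite exchange_big /= big_map big_enum /= -sum1_card [RHS]big_mkcond /=.
apply: eq_bigr => i _; rewrite -big_mkcond sum1_count.
under eq_count do rewrite eq_sym.
rewrite (count_uniq_mem _ (undup_uniq _)) mem_undup mem_filter inE map_f ?mem_enum//.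
by rewrite andbT; case: ifP.
Qed.

Lemma posdef_mx1 (R : realDomainType) n : posdef_mx (1%:M : 'M[R]_n).
Proof.
move=> v v0; rewrite mulmx1 mxE.
rewrite lt0r psumr_eq0 ?sumr_ge0 ?andbT => [|i _|i _]; last 2 first.
- by rewrite mxE -expr2 sqr_ge0.
- by rewrite mxE -expr2 sqr_ge0.
apply: contra v0 => /allP v0; apply/eqP/rowP => i; rewrite mxE.
have /(_ (mem_index_enum i)) := v0 i.
by rewrite mxE -expr2 sqrf_eq0 => /eqP.
Qed.

Lemma simdiag_neq0 (F : fieldType) n (G H P : 'M[F]_n) (d : 'rV[F]_n) i :
  P \in unitmx -> \rank H = n -> P *m H = diag_mx d *m P *m G -> d 0 i != 0.
Proof.
move=> Pu Hr PE.
have PH : row_free (P *m H) by rewrite /row_free mxrankMfree ?mxrank_unit// /row_free Hr.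
apply/eqP => di0; have := congr1 (row i) PE.
rewrite -mulmxA row_diag_mul di0 scale0r rowE => /eqP.
rewrite mulmx_free_eq0// => /eqP/rowP/(_ i)/eqP.
by rewrite !mxE !eqxx oner_eq0.
Qed.

(** H is also diagonalized with respect to the identity, which yields its own eigenvalues; inertia
    applied in both directions shows that the two counts of negative values agree. *)
Lemma negative_eigenvalues_index (R : realType) n (G H P : 'M[R]_n)
    (d : 'rV[R]_n) k :
  G^T = G -> posdef_mx G -> H^T = H -> P \in unitmx -> \rank H = n ->
  P *m H = diag_mx d *m P *m G -> (k <= n)%N ->
  (forall i : 'I_n, (i < k)%N -> d 0 i < 0) ->
  (forall i : 'I_n, (k <= i)%N -> 0 < d 0 i) ->
  negative_eigenvalues H = k.
Proof.
move=> GT Gp HT Pu Hr PE kn dn dp.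
have [k' [P' [d' [k'n P'u P'E d'n d'ge0]]]] :=
  simultaneous_diag (trmx1 R n) (@posdef_mx1 R n) HT.
have d'p (i : 'I_n) : (k' <= i)%N -> 0 < d' 0 i.
  by move=> ki; rewrite lt0r (simdiag_neq0 i P'u Hr P'E) d'ge0.
have -> : k = k'.
  apply/eqP; rewrite eqn_leq.
  rewrite (inertia_le GT Gp (trmx1 R n) (@posdef_mx1 R n) HT Pu P'u PE P'E)//.
  by rewrite (inertia_le (trmx1 R n) (@posdef_mx1 R n) GT Gp HT P'u Pu P'E PE).
rewrite (@negative_eigenvalues_simdiag _ _ _ P' d')//; last by rewrite P'E mulmx1.
have -> : [set i | d' 0 i < 0]%SET = [set i : 'I_n | (i < k')%N]%SET.
  apply/setP => i; rewrite !inE; case: ltnP => [/d'n //|/d'p /ltW].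
  by rewrite leNgt => /negbTE.
rewrite -sum1_card -[RHS]card_ord -[RHS]sum1_card (big_ord_widen n (fun=> 1%N))//.
by apply: eq_bigl => i; rewrite inE.
Qed.

(** * Second order estimates *)

(** Differentials depend on germs only. This matters because formulas in charts hold only on open
    sets, while the functions are total and arbitrary elsewhere. *)
Lemma near_eq_differentiable (R : numFieldType) (V W : normedModType R) (f g : V -> W) x :
  {near x, f =1 g} -> differentiable f x ->
  differentiable g x /\ 'd g x = 'd f x :> (V -> W).
Proof.
move=> fg df.
have gE : g \o shift x = cst (g x) + 'd f x +o_ 0 id.
  apply/eqaddoP => e e0; have /eqaddoP/(_ e e0) := diff_locally df.
  apply: filter_app; have : \forall h \near 0, f (h + x) = g (h + x).
    by move: fg; rewrite (near_shift 0) subr0.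
  apply: filterS => h /= fgh; rewrite /= !fctE /= fgh.
  by rewrite (nbhs_singleton fg).
have dgE : 'd g x = 'd f x :> (V -> W).
  by apply: diff_unique => //; exact: diff_continuous.
split=> //; apply/diff_locallyP; rewrite dgE; split=> //.
exact: diff_continuous.
Qed.

Section Estimates.
Context {R : realType} {n : nat}.
Implicit Types (x v : 'rV[R]_n) (h : 'rV[R]_n -> R).

Lemma coord_norm_le v i : `|v 0 i| <= `|v|.
Proof.
rewrite [leRHS]/Num.norm /= mx_normrE.
exact: (@le_bigmax _ _ _ 0 (fun ij : 'I_1 * 'I_n => `|v ij.1 ij.2|) (0, i)).
Qed.

Lemma row_norm_le v (C : R) : 0 <= C -> (forall i, `|v 0 i| <= C) -> `|v| <= C.
Proof.
move=> C0 vC; rewrite [leLHS]/Num.norm /= mx_normrE.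
by apply/bigmax_leP; split=> // -[i j] _; rewrite ord1.
Qed.

Lemma partialE {V : normedModType R} (h : 'rV[R]_n -> V) i x :
  differentiable h x -> partial i h x = 'd h x (delta_mx 0 i).
Proof. exact: deriveE. Qed.

Lemma diff_partial {V : normedModType R} (h : 'rV[R]_n -> V) x v :
  differentiable h x -> 'd h x v = \sum_i v 0 i *: partial i h x.
Proof.
move=> dh; rewrite [in LHS](row_sum_delta v) linear_sum; apply: eq_bigr => i _.
by rewrite linearZ partialE.
Qed.

Lemma differentiable_near_lipschitz h x : differentiable h x ->
  exists2 C, 0 < C & \forall v \near (0 : 'rV[R]_n), `|h (v + x) - h x| <= C * `|v|.
Proof.
move=> dh; have [C C0 dC] := linear_lipschitz (diff_continuous dh).
exists (C + 1); first by rewrite addr_gt0.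
have /eqaddoP/(_ 1 ltr01) := diff_locally dh.
apply: filterS => v /=; rewrite !fctE /= mul1r => hv.
rewrite mulrDl mul1r (_ : _ - _ = 'd h x v + (h (v + x) - (h x + 'd h x v))).
  by rewrite (le_trans (ler_normD _ _))// lerD.
by ring.
Qed.

Lemma is_derive_line h (t : R) v y : differentiable h (t *: v + y) ->
  is_derive t 1 (fun s : R => h (s *: v + y)) ('d h (t *: v + y) v).
Proof.
move=> dh.
have dline : is_diff t (fun s : R => s *: v + y) (fun s => s *: v).
  apply: (is_diff_eq (is_diffD (is_diff_scalel t v) (is_diff_cst y t))).
  by rewrite addr0.
have dhl := @is_diff_comp _ _ _ _ _ _ _ _ t dline (differentiableP dh).
apply: DeriveDef; first exact/diff_derivable/ex_diff.
by rewrite deriveE ?diff_val /= ?scale1r.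
Qed.

(** The mean value theorem on the segment from x to v + x, applied to h minus its linear part,
    leaves a difference of differentials evaluated at v. Each partial derivative changes by O(|v|),
    which gives the second factor |v|. *)
Lemma taylor2 h x : (\forall y \near x, differentiable h y) ->
  (forall i, differentiable (partial i h) x) ->
  exists2 C, 0 < C &
    \forall v \near (0 : 'rV[R]_n), `|h (v + x) - h x - 'd h x v| <= C * `|v| ^+ 2.
Proof.
move=> dh dph.
have /choice[C CP] i : exists C : R, 0 < C /\ \forall v \near (0 : 'rV[R]_n),
    `|partial i h (v + x) - partial i h x| <= C * `|v|.
  by have [C C0 CP] := differentiable_near_lipschitz (dph i); exists C.
(* The summand 1 keeps the constant positive when n = 0. *)
exists (1 + \sum_i C i).
  by rewrite ltr_wpDr// sumr_ge0// => i _; have [/ltW] := CP i.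
have dh0 : \forall v \near (0 : 'rV[R]_n), differentiable h (v + x).
  by move: dh; rewrite (near_shift 0) subr0.
have CP0 : \forall v \near (0 : 'rV[R]_n), forall i,
    `|partial i h (v + x) - partial i h x| <= C i * `|v|.
  exact: (@filter_forall _ _ (fun i v =>
    `|partial i h (v + x) - partial i h x| <= C i * `|v|) _ _ (fun i => (CP i).2)).
have [e /= e0 eP] := (nbhs_ballP _ _).1 (filterI dh0 CP0).
near=> v.
have ve (t : R) : 0 <= t -> t <= 1 -> ball 0 e (t *: v).
  move=> t0 t1; rewrite -ball_normE /= sub0r normrN normrZ ger0_norm//.
  apply: (@le_lt_trans _ _ `|v|); first by rewrite ler_piMl.
  near: v; apply/nbhs_ballP; exists e => //= w.
  by rewrite -ball_normE /= sub0r normrN.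
pose phi t : R := h (t *: v + x) - t * 'd h x v.
pose dphi t : R := 'd h (t *: v + x) v - 'd h x v.
have phi_der (t : R) : 0 <= t -> t <= 1 -> is_derive t 1 phi (dphi t).
  move=> t0 t1.
  have [dht _] := eP _ (ve t t0 t1).
  apply: is_deriveB; first exact: is_derive_line.
  have : is_derive t (1 : R) ( *:%R^~ ('d h x v) : R -> R) (1 *: 'd h x v).
    by apply: DeriveDef; [exact/diff_derivable/ex_diff | rewrite deriveE ?diff_val].
  by rewrite scale1r.
have phi_cont : {within `[0, 1], continuous phi}.
  apply: derivable_within_continuous => t; rewrite in_itv /= => /andP[t0 t1].
  by have [] := phi_der t t0 t1.
have [|c] := MVT_segment (@ler01 R) _ phi_cont (df := dphi).
  by move=> t; rewrite in_itv /= => /andP[/ltW t0 /ltW t1]; exact: phi_der.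
rewrite in_itv /= => /andP[c0 c1].
rewrite /phi scale1r scale0r add0r mul1r mul0r !subr0 mulr1 => phiE.
rewrite addrAC phiE /dphi.
have [dhc hc] := eP _ (ve c c0 c1).
have dhx : differentiable h x := nbhs_singleton dh.
rewrite [X in `|X - _|](diff_partial v dhc) [X in `|_ - X|](diff_partial v dhx).
rewrite -sumrB (le_trans (ler_norm_sum _ _ _))//.
rewrite mulrDl mul1r ler_wpDl ?sqr_ge0// mulr_suml ler_sum// => i _.
rewrite -scalerBr normrZ expr2 mulrA [C i * _]mulrC -mulrA.
apply: ler_pM => //; first exact: coord_norm_le.
rewrite (le_trans (hc i))// ler_wpM2l//; first by have [/ltW] := CP i.
by rewrite normrZ ger0_norm// ler_piMl.
Unshelve. all: by end_near. Qed.

Lemma norm_delta_mx_le1 i : `|delta_mx 0 i : 'rV[R]_n| <= 1.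
Proof.
apply: row_norm_le => // j; rewrite mxE /=.
by case: eqP => _; rewrite ?normr1 ?normr0.
Qed.

(* The second difference is symmetric in i and j: comparing the estimates for
   (i, j) and (j, i) shows that the mixed partial derivatives agree. *)
Lemma second_difference h x i j :
  (\forall y \near x, differentiable h y) ->
  (\forall y \near x, differentiable (partial i h) y) ->
  (forall l, differentiable (partial l (partial i h)) x) ->
  exists C : R, \forall t \near (0 : R)^'+,
    `|h (t *: delta_mx 0 i + (t *: delta_mx 0 j + x)) - h (t *: delta_mx 0 i + x)
      - (h (t *: delta_mx 0 j + x) - h x) - t ^+ 2 * partial j (partial i h) x|
    <= C * t ^+ 3.
Proof.
move=> dh dk ddk; have [C C0 CP] := taylor2 dk ddk.
set k := partial i h in dk ddk CP *.
set ei : 'rV[R]_n := delta_mx 0 i; set ej : 'rV[R]_n := delta_mx 0 j.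
(* The mean value theorem in direction i produces points at distance at most 2t and t from x; the
   two Taylor errors of [k] there add up to C (4 + 1) t^2. *)
exists (C * 5).
have dh0 : \forall v \near (0 : 'rV[R]_n), differentiable h (v + x).
  by move: dh; rewrite (near_shift 0) subr0.
have [e /= e0 eP] := (nbhs_ballP _ _).1 (filterI dh0 CP).
near=> t.
have t0 : 0 < t by [].
have te : t < e / 2 by near: t; apply: nbhs_right_lt; rewrite divr_gt0.
have norm2 a b : 0 <= a -> a <= t -> 0 <= b -> b <= t ->
    `|a *: ei + b *: ej| <= a + b.
  move=> a0 at_ b0 bt; rewrite (le_trans (ler_normD _ _))// lerD// normrZ ger0_norm//.
    by rewrite ler_piMr// norm_delta_mx_le1.
  by rewrite ler_piMr// norm_delta_mx_le1.
have inball a b : 0 <= a -> a <= t -> 0 <= b -> b <= t ->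
    ball 0 e (a *: ei + b *: ej).
  move=> a0 at_ b0 bt; rewrite -ball_normE /= sub0r normrN.
  apply: (le_lt_trans (norm2 a b a0 at_ b0 bt)).
  apply: (@le_lt_trans _ _ (t + t)); first exact: lerD.
  by rewrite [e]splitr ltrD.
pose phi s : R := h (s *: ei + (t *: ej + x)) - h (s *: ei + x).
pose dphi s : R := k (s *: ei + (t *: ej + x)) - k (s *: ei + x).
have phi_der (s : R) : 0 <= s -> s <= t -> is_derive s 1 phi (dphi s).
  move=> s0 st.
  have [] := eP _ (inball s t s0 st (ltW t0) (lexx t)); rewrite -addrA => d1 _.
  have [] := eP _ (inball s 0 s0 st (lexx 0) (ltW t0)); rewrite scale0r addr0 => d2 _.
  rewrite /dphi /k !partialE//.
  by apply: is_deriveB; exact: is_derive_line.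
have phi_cont : {within `[0, t], continuous phi}.
  apply: derivable_within_continuous => s; rewrite in_itv /= => /andP[s0 st].
  by have [] := phi_der s s0 st.
have [|c] := MVT_segment (ltW t0) _ phi_cont (df := dphi).
  by move=> s; rewrite in_itv /= => /andP[/ltW s0 /ltW st]; exact: phi_der.
rewrite in_itv /= => /andP[c0 ct] phiE.
have {phiE} -> : h (t *: ei + (t *: ej + x)) - h (t *: ei + x) - (h (t *: ej + x) - h x)
    = dphi c * t.
  by rewrite -[t in RHS]subr0 -phiE /phi !scale0r !add0r.
have [_] := eP _ (inball c t c0 ct (ltW t0) (lexx t)); rewrite -(addrA (c *: ei)) => b1.
have [_] := eP _ (inball c 0 c0 ct (lexx 0) (ltW t0)); rewrite scale0r addr0 => b2.
have -> : dphi c * t - t ^+ 2 * partial j k x =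
    t * ((k (c *: ei + (t *: ej + x)) - k x - 'd k x (c *: ei + t *: ej))
       - (k (c *: ei + x) - k x - 'd k x (c *: ei))).
  rewrite /dphi linearD !linearZ /= partialE; last exact: nbhs_singleton dk.
  by rewrite /GRing.scale /=; ring.
rewrite normrM gtr0_norm// mulrC exprSr mulrA ler_wpM2r ?(ltW t0)//.
rewrite (le_trans (ler_normB _ _))// (le_trans (lerD b1 b2))//.
rewrite -mulrDr -mulrA ler_pM2l//.
rewrite (_ : 5 * t ^+ 2 = (t + t) ^+ 2 + t ^+ 2); last by ring.
apply: lerD; rewrite ler_sqr ?nnegrE ?addr_ge0 ?(ltW t0)//.
  by rewrite (le_trans (norm2 c t c0 ct (ltW t0) (lexx t)))// lerD2r.
have := norm2 c 0 c0 ct (lexx 0) (ltW t0).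
by rewrite scale0r !addr0 => /le_trans; apply.
Unshelve. all: by end_near. Qed.

Lemma partial_comm h x i j :
  (\forall y \near x, differentiable h y) ->
  (\forall y \near x, forall l, differentiable (partial l h) y) ->
  (forall l m, differentiable (partial l (partial m h)) x) ->
  partial i (partial j h) x = partial j (partial i h) x.
Proof.
move=> dh dph ddph.
have dph' l : \forall y \near x, differentiable (partial l h) y.
  by apply: filterS dph => y; apply.
have [C1 C1P] := second_difference j dh (dph' i) (ddph^~ i).
have [C2 C2P] := second_difference i dh (dph' j) (ddph^~ j).
set a := partial i _ _; set b := partial j _ _.
apply/eqP; rewrite -subr_eq0 -normr_le0; apply/ler_addgt0Pr => e e0.
rewrite add0r.
(* After division by t^2 the bound is (C1 + C2) t; absolute values are taken because the signs of C1
   and C2 are unknown. *)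
have [t [t0 te tb]] : exists t : R, [/\ 0 < t, (`|C1| + `|C2|) * t <= e &
    t ^+ 2 * `|a - b| <= (C1 + C2) * t ^+ 3].
  near (0 : R)^'+ => t; exists t; split=> //.
    apply: (@le_trans _ _ ((`|C1| + `|C2| + 1) * t)); first by rewrite ler_wpM2r// lerDl.
    rewrite mulrC -ler_pdivlMr ?ltr_wpDl ?addr_ge0//.
    near: t; apply: nbhs_right_le.
    by rewrite divr_gt0// ltr_wpDl// addr_ge0.
  have h1 := near C1P t _; have h2 := near C2P t _.
  rewrite -[t ^+ 2](@ger0_norm _ (t ^+ 2)) ?sqr_ge0// -normrM mulrDl.
  rewrite (le_trans _ (lerD (h1 _) (h2 _)))//.
  apply: le_trans (ler_normB _ _).
  rewrite le_eqVlt; apply/orP; left; apply/eqP; congr `|_|.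
  rewrite -/a -/b !addrA [t *: delta_mx 0 j + t *: delta_mx 0 i]addrC; ring.
apply: (le_trans _ te); rewrite -(ler_pM2l (exprn_gt0 2 t0)) (le_trans tb)//.
rewrite [leRHS](_ : _ = (`|C1| + `|C2|) * t ^+ 3); last by ring.
by rewrite ler_wpM2r ?exprn_ge0 ?(ltW t0)// lerD ?ler_norm.
Unshelve. all: by end_near. Qed.
End Estimates.

(** * Smooth maps and affine maps *)

Section AffineMaps.
Context {R : realType} {n : nat}.
Implicit Types (A : 'M[R]_n) (v x b : 'rV[R]_n).

Lemma mulmx_norm_le v A : `|v *m A| <= `|v| * \sum_i \sum_j `|A i j|.
Proof.
apply: row_norm_le => [|j].
  by rewrite mulr_ge0// sumr_ge0// => i _; rewrite sumr_ge0.
rewrite mxE (le_trans (ler_norm_sum _ _ _))// mulr_sumr ler_sum// => i _.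
rewrite normrM; apply: ler_pM => //; first exact: coord_norm_le.
by rewrite (bigD1 j)//= lerDl sumr_ge0.
Qed.

Lemma mulmxr_continuous A : continuous (mulmxr A : 'rV[R]_n -> 'rV[R]_n).
Proof.
apply: bounded_linear_continuous; apply/linear_boundedP.
exists (\sum_i \sum_j `|A i j|); split; first exact: num_real.
move=> r /ltW rA v; rewrite mulrC (le_trans (mulmx_norm_le v A))// ler_wpM2l//.
Qed.

Lemma is_diff_affine A b x :
  is_diff x (fun v => v *m A + b) (mulmx^~ A).
Proof.
have dA : is_diff x (mulmxr A) (mulmxr A).
  apply: DiffDef; first exact/linear_differentiable/mulmxr_continuous.
  exact/diff_lin/mulmxr_continuous.
by refine (is_diff_eq (is_diffD dA (is_diff_cst b x)) _); rewrite addr0.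
Qed.
End AffineMaps.

Section SmoothOn.
Context {R : realType} {n : nat} {V : normedModType R}.
Implicit Types (U : set 'rV[R]_n) (h : 'rV[R]_n -> V).

Lemma partial_ext U h h' i : open U -> {in U, h =1 h'} ->
  {in U, partial i h =1 partial i h'}.
Proof.
move=> oU hh x /set_mem Ux; apply: near_eq_derive.
by apply: filterS (open_nbhs_nbhs (conj oU Ux)) => y Uy; apply: hh; exact: mem_set.
Qed.

Lemma C_on_ext k U h h' : open U -> {in U, h =1 h'} -> C_on k U h -> C_on k U h'.
Proof.
move=> oU; elim: k h h' => [|k IH] h h' hh /=; first exact: subspace_eq_continuous.
move=> [dh ph]; split=> [x Ux|i]; last first.
  exact: IH (partial_ext i oU hh) (ph i).
have [] // := @near_eq_differentiable _ _ _ h h' x _ (dh x Ux).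
by apply: filterS (open_nbhs_nbhs (conj oU Ux)) => y Uy; apply: hh; exact: mem_set.
Qed.

(** Serves the chain rule for an affine inner map: the partial derivatives of the composite are
    combinations, with constant coefficients, of those of the outer function, so that induction on k
    goes through. *)
Lemma C_on_lincomb k U m (a : 'I_m -> R) (h : 'I_m -> 'rV[R]_n -> V) : open U ->
  (forall j, C_on k U (h j)) -> C_on k U (fun x => \sum_j a j *: h j x).
Proof.
move=> oU; elim: k h => [|k IH] h /=.
  move=> ch; rewrite continuous_open_subspace// => x Ux.
  apply: (@cvg_big _ _ _ _ _ (@add_continuous V) _ (nbhs x)) => j _.
  apply: cvgZl_tmp; have := ch j; rewrite continuous_open_subspace//; exact.
move=> ch; split=> [x Ux|i].
  rewrite -(fct_sumE _ xpredT (fun j x => a j *: h j x)); apply: differentiable_sum => j.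
  by apply: differentiableZ; have [+ _] := ch j; apply.
apply: (@C_on_ext _ _ (fun x => \sum_j a j *: partial i (h j) x)) => //.
  move=> x /set_mem Ux; have dh j : differentiable (h j) x by have [+ _] := ch j; apply.
  rewrite /partial -(fct_sumE _ xpredT (fun j x => a j *: h j x)).
  rewrite derive_sum => [|j]; last exact/diff_derivable/differentiableZ.
  by apply: eq_bigr => j _; rewrite deriveZ//; exact: diff_derivable.
by apply: IH => j; have [_] := ch j; apply.
Qed.
End SmoothOn.

Section SmoothOnAffine.
Context {R : realType} {n : nat}.
Implicit Types (U : set 'rV[R]_n) (A : 'M[R]_n) (b : 'rV[R]_n).

Lemma C_on_affine_pre {V : normedModType R} k U U' A b (h : 'rV[R]_n -> V) :
  open U -> open U' -> (forall x, U' x -> U (x *m A + b)) ->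
  C_on k U h -> C_on k U' (fun x => h (x *m A + b)).
Proof.
move=> oU oU' UU'; elim: k h => [|k IH] h /=.
  rewrite !continuous_open_subspace// => ch x /set_mem U'x.
  apply: (@continuous_comp _ _ _ (fun x : 'rV[R]_n => x *m A + b) h).
    exact/differentiable_continuous/(@ex_diff _ _ _ _ _ _ _ (is_diff_affine A b x)).
  by apply: ch; exact/mem_set/UU'.
move=> [dh ph].
have dcomp x : U' x -> is_diff x (h \o (fun x => x *m A + b))
    ('d h (x *m A + b) \o mulmx^~ A).
  move=> U'x; apply: is_diff_comp (is_diff_affine A b x) _.
  exact/differentiableP/dh/UU'.
split=> [x U'x|i]; first exact: (@ex_diff _ _ _ _ _ _ _ (dcomp x U'x)).
apply: (@C_on_ext _ _ _ _ _ (fun x => \sum_j A i j *: partial j h (x *m A + b))) => //.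
  move=> x /set_mem U'x; have dx := dcomp x U'x.
  rewrite [RHS]partialE; last exact: (@ex_diff _ _ _ _ _ _ _ dx).
  rewrite [in RHS](@diff_val _ _ _ _ _ _ _ dx) /= -rowE diff_partial; last exact/dh/UU'.
  by apply: eq_bigr => j _; rewrite mxE.
by apply: C_on_lincomb => // j; exact/IH/ph.
Qed.

Lemma C_on_affine_post k U A b (h : 'rV[R]_n -> 'rV[R]_n) :
  open U -> C_on k U h -> C_on k U (fun x => h x *m A + b).
Proof.
move=> oU; elim: k b h => [|k IH] b h /=.
  rewrite !continuous_open_subspace// => ch x Ux.
  apply: (@continuous_comp _ _ _ h (fun x : 'rV[R]_n => x *m A + b)); first exact: ch.
  exact/differentiable_continuous/(@ex_diff _ _ _ _ _ _ _ (is_diff_affine A b (h x))).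
move=> [dh ph].
have dcomp x : U x -> is_diff x ((fun x => x *m A + b) \o h) (mulmx^~ A \o 'd h x).
  move=> Ux; apply: is_diff_comp; last exact: is_diff_affine.
  exact/differentiableP/dh.
split=> [x Ux|i]; first exact: (@ex_diff _ _ _ _ _ _ _ (dcomp x Ux)).
(* Differentiation replaces b by 0; the term [+ 0] keeps the shape of the induction hypothesis,
   which is general in b. *)
apply: (@C_on_ext _ _ _ _ _ (fun x => partial i h x *m A + 0)) => //; last exact/IH/ph.
move=> x /set_mem Ux; have dx := dcomp x Ux.
rewrite [RHS]partialE; last exact: (@ex_diff _ _ _ _ _ _ _ dx).
by rewrite [in RHS](@diff_val _ _ _ _ _ _ _ dx) /= addr0 partialE//; exact: dh.
Qed.
End SmoothOnAffine.

Section SmoothOnFacts.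
Context {R : realType} {n : nat} {V : normedModType R}.
Implicit Types (U : set 'rV[R]_n) (h : 'rV[R]_n -> V).

Lemma smooth_on_partial U h i : smooth_on U h -> smooth_on U (partial i h).
Proof. by move=> sh k; have [_] := sh k.+1; apply. Qed.

Lemma smooth_on_differentiable U h x : smooth_on U h -> U x -> differentiable h x.
Proof. by move=> sh; have [+ _] := sh 1%N; apply. Qed.

Lemma smooth_on_near U h x : open U -> smooth_on U h -> U x ->
  \forall y \near x, differentiable h y.
Proof.
move=> oU sh Ux; apply: filterS (open_nbhs_nbhs (conj oU Ux)) => y.
exact: smooth_on_differentiable.
Qed.
End SmoothOnFacts.

Lemma smooth_partial_comm {R : realType} {n : nat} (U : set 'rV[R]_n)
    (h : 'rV[R]_n -> R) x i j : open U -> smooth_on U h -> U x ->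
  partial i (partial j h) x = partial j (partial i h) x.
Proof.
move=> oU sh Ux; apply: partial_comm; first exact: smooth_on_near Ux.
  apply: filterS (open_nbhs_nbhs (conj oU Ux)) => y Uy l.
  exact/(smooth_on_differentiable _ Uy)/smooth_on_partial.
by move=> l m; apply: smooth_on_differentiable Ux; do 2!apply: smooth_on_partial.
Qed.

(** * Changes of coordinates *)

Lemma param_cvg {R : realType} {n : nat} {X : topologicalType} (c : chart R n X) q :
  dom c q -> param c y @[y --> coords c q] --> q.
Proof.
move=> cq; have /= := param_continuous (c := c).
rewrite continuous_open_subspace; last exact: image_open.
have cc : coords c q \in coords c @` dom c by apply/mem_set; exists q.
by move=> /(_ _ cc); rewrite /continuous_at coordsK.
Qed.

Lemma overlap_open {R : realType} {n : nat} {X : topologicalType} (c d : chart R n X) :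
  open (coords c @` (dom c `&` dom d)).
Proof.
rewrite openE => _ [q [cq dq] <-].
have h1 : nbhs (coords c q) (coords c @` dom c).
  by apply: open_nbhs_nbhs; split; [exact: image_open|exists q].
have h2 := param_cvg cq (open_nbhs_nbhs (conj (dom_open d) dq)).
apply: filterS (filterI h1 h2) => _ [[r cr <-]]; rewrite /= coordsK// => dr.
by exists r.
Qed.

Section Charts.
Context {R : realType} {n : nat} {X : smooth_manifold R n}.
Implicit Types (f : X -> R) (c d : chart R n X) (p q : X).

Lemma transition_coords c d q : dom c q -> transition c d (coords c q) = coords d q.
Proof. by move=> cq; rewrite /transition /= coordsK. Qed.

Lemma local_expr_transition f c d :
  {in coords c @` (dom c `&` dom d),
    local_expr f c =1 local_expr f d \o transition c d}.
Proof.
by move=> x /set_mem[q [cq dq] <-]; rewrite /local_expr /= transition_coords// !coordsK.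
Qed.

Lemma transition_smooth c d : atlas X c -> atlas X d ->
  smooth_on (coords c @` (dom c `&` dom d)) (transition c d).
Proof. by move=> Ac Ad; have [] := atlas_compatible Ac Ad. Qed.

Lemma partial_local_expr f c d i q : smooth_function f ->
  atlas X c -> atlas X d -> dom c q -> dom d q ->
  partial i (local_expr f c) (coords c q) =
  \sum_l 'J (transition c d) (coords c q) i l * partial l (local_expr f d) (coords d q).
Proof.
move=> sf Ac Ad cq dq.
have ov : (coords c @` (dom c `&` dom d)) (coords c q) by exists q.
have dt : differentiable (transition c d) (coords c q).
  exact: (smooth_on_differentiable (transition_smooth Ac Ad)).
have df : differentiable (local_expr f d) (coords d q).
  by apply: (smooth_on_differentiable (sf d Ad)); exists q.
rewrite (partial_ext i (@overlap_open _ _ _ c d) (@local_expr_transition f c d)) ?mem_set//.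
rewrite partialE; last by apply: differentiable_comp => //; rewrite transition_coords.
rewrite diff_comp ?transition_coords//= diff_partial//.
by apply: eq_bigr => l _; rewrite /jacobian /lin1_mx mxE.
Qed.

Lemma differential_change f c d q : smooth_function f ->
  atlas X c -> atlas X d -> dom c q -> dom d q ->
  differential f c (coords c q) =
  differential f d (coords d q) *m ('J (transition c d) (coords c q))^T.
Proof.
move=> sf Ac Ad cq dq; apply/rowP => i; rewrite !mxE (partial_local_expr _ sf Ac Ad cq dq).
by apply: eq_bigr => l _; rewrite !mxE mulrC.
Qed.

(* The second derivatives of the transition map are multiplied by the first
   derivatives of f, which vanish at q. *)
Lemma hessian_change f c d q : smooth_function f ->
  atlas X c -> atlas X d -> dom c q -> dom d q -> differential f d (coords d q) = 0 ->
  hessian f c (coords c q) =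
  'J (transition c d) (coords c q) *m hessian f d (coords d q)
    *m ('J (transition c d) (coords c q))^T.
Proof.
move=> sf Ac Ad cq dq df0; set x := coords c q.
set T := transition c d; set O := coords c @` (dom c `&` dom d).
have oO : open O by exact: overlap_open.
have Ox : O x by exists q.
have sT : smooth_on O T by exact: transition_smooth.
have dT : differentiable T x by exact: smooth_on_differentiable sT Ox.
have Tx : T x = coords d q by exact: transition_coords.
have JE i l y : O y -> 'J T y i l = partial i T y 0 l.
  move=> Oy; rewrite partialE /jacobian /lin1_mx ?mxE//.
  exact: smooth_on_differentiable sT Oy.
have dq' : coords_image d (coords d q) by exists q.
have ph0 l : partial l (local_expr f d) (coords d q) = 0.
  by have /rowP/(_ l) := df0; rewrite !mxE.
apply/matrixP => i j; rewrite [LHS]mxE.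
pose F l y := partial j T y 0 l * (partial l (local_expr f d) \o T) y.
rewrite (@partial_ext _ _ _ O _ (fun y => \sum_l F l y) i) ?mem_set//; last first.
  move=> _ /set_mem[r [cr dr] <-]; rewrite (partial_local_expr _ sf Ac Ad cr dr).
  apply: eq_bigr => l _; rewrite /F /= -/T JE; last by exists r.
  by rewrite /T transition_coords.
have d1 l : differentiable (fun y => partial j T y 0 l) x.
  apply: (@differentiable_comp _ _ _ _ (partial j T) (fun v : 'rV[R]_n => v 0 l)).
    exact: smooth_on_differentiable (smooth_on_partial j sT) Ox.
  exact: differentiable_coord.
have d2' l : differentiable (partial l (local_expr f d)) (T x).
  rewrite Tx; apply: smooth_on_differentiable dq'.
  exact/smooth_on_partial/sf.
have d2 l : differentiable (partial l (local_expr f d) \o T) x.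
  exact: differentiable_comp.
rewrite /partial -(fct_sumE _ xpredT F) derive_sum => [|l]; last first.
  exact/diff_derivable/differentiableM.
rewrite -mulmxA mxE.
under [RHS]eq_bigr do rewrite [X in _ * X]mxE mulr_sumr.
rewrite exchange_big /=; apply: eq_bigr => l _.
rewrite deriveM; [|exact: diff_derivable..].
rewrite /= Tx ph0 scale0r addr0 deriveE// diff_comp//= -partialE// Tx diff_partial -?Tx//.
rewrite /GRing.scale /= mulr_sumr; apply: eq_bigr => m _.
by rewrite [hessian f d _ m l]mxE [_^T l j]mxE !JE//; ring.
Qed.
End Charts.

(** * Affine changes of a chart *)

Section AffineChart.
Context {R : realType} {n : nat} {X : topologicalType}.
Variables (c : chart R n X) (A : 'M[R]_n) (b : 'rV[R]_n).
Hypothesis A_unit : A \in unitmx.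

Let aff (x : 'rV[R]_n) := x *m A + b.
Let aff_inv (y : 'rV[R]_n) := y *m invmx A + - b *m invmx A.

Let affK : cancel aff aff_inv.
Proof. by move=> x; rewrite /aff_inv /aff mulNmx -mulmxBl addrK mulmxK. Qed.

Let aff_invK : cancel aff_inv aff.
Proof. by move=> y; rewrite /aff_inv /aff -mulmxDl mulmxKV// subrK. Qed.

Let affine_continuous (B : 'M[R]_n) (v : 'rV[R]_n) :
  continuous (fun x : 'rV[R]_n => x *m B + v).
Proof.
move=> x; apply: differentiable_continuous.
exact: (@ex_diff _ _ _ _ _ _ _ (is_diff_affine B v x)).
Qed.

(** As a preimage under the continuous inverse, the new image is open. *)
Let imageE : (aff \o coords c) @` dom c = aff_inv @^-1` (coords c @` dom c).
Proof.
apply/seteqP; split=> [_ [q cq <-]|y [q cq qE]]; exists q => //.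
  exact/esym/affK.
by rewrite -[RHS]aff_invK -qE.
Qed.

Let affine_image_open : open ((aff \o coords c) @` dom c).
Proof.
rewrite imageE; apply: open_comp; last exact: image_open.
by move=> x _; exact: affine_continuous.
Qed.

Let affine_coordsK q : dom c q -> (param c \o aff_inv) ((aff \o coords c) q) = q.
Proof. by move=> cq; rewrite /= affK coordsK. Qed.

Let affine_coords_continuous : {within dom c, continuous (aff \o coords c)}.
Proof.
apply: within_continuous_comp; last exact: coords_continuous.
by move=> x _; exact: affine_continuous.
Qed.

Let affine_param_continuous :
  {within (aff \o coords c) @` dom c, continuous (param c \o aff_inv)}.
Proof.
rewrite continuous_open_subspace// => y; rewrite imageE => /set_mem ycq.
apply: continuous_comp; first exact: affine_continuous.
have := param_continuous (c := c); rewrite continuous_open_subspace; last exact: image_open.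
by apply; exact: mem_set.
Qed.

Definition affine_chart : chart R n X :=
  Chart (dom_open c) affine_image_open affine_coordsK affine_coords_continuous
    affine_param_continuous.

Lemma coords_affine_chart q : coords affine_chart q = coords c q *m A + b.
Proof. by []. Qed.

Lemma transition_affine_chart_l d :
  transition affine_chart d = fun y => transition c d (y *m invmx A + - b *m invmx A).
Proof. by []. Qed.

Lemma transition_affine_chart_r d :
  transition d affine_chart = fun y => transition d c y *m A + b.
Proof. by []. Qed.

Lemma compatible_affine_chart d : compatible c d -> compatible affine_chart d.
Proof.
move=> [cd dc]; split=> k.
- rewrite transition_affine_chart_l.
  apply: C_on_affine_pre (cd k); first exact: overlap_open.
    exact: (@overlap_open _ _ _ affine_chart d).
  by move=> _ [q [cq dq] <-]; exists q => //; rewrite -[LHS]affK.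
- rewrite transition_affine_chart_r; apply: C_on_affine_post (dc k).
  by rewrite setIC; exact: overlap_open.
Qed.

Lemma jacobian_affine_chart x : (coords c @` dom c) x ->
  'J (transition c affine_chart) x = A.
Proof.
move=> [q cq qx]; have dA := is_diff_affine A b x.
have h : {near x, aff =1 transition c affine_chart}.
  have : nbhs x (coords c @` dom c).
    by apply: open_nbhs_nbhs; split; [exact: image_open|exists q].
  by apply: filterS => _ [r cr <-]; rewrite transition_affine_chart_r /transition /= coordsK.
have [_ dE] := near_eq_differentiable h (@ex_diff _ _ _ _ _ _ _ dA).
apply/matrixP => i j; rewrite /jacobian /lin1_mx mxE dE.
by rewrite (@diff_val _ _ _ _ _ _ _ dA) -rowE mxE.
Qed.
End AffineChart.

(** Maximality of the atlas reduces membership to compatibility with its charts. *)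
Lemma affine_chart_atlas {R : realType} {n : nat} (X : smooth_manifold R n)
    (c : chart R n X) A b (A_unit : A \in unitmx) :
  atlas X c -> atlas X (affine_chart c b A_unit).
Proof.
move=> Ac; apply: atlas_maximal => d Ad.
exact/compatible_affine_chart/atlas_compatible.
Qed.

(** * First order expansion of the gradient at a critical point *)

Section Gradient.
Context {R : realType} {n : nat} {X : smooth_manifold R n}.
Variables (g : riemannian_metric X) (f : X -> R) (p : X).
Hypothesis f_smooth : smooth_function f.
Implicit Types (c d : chart R n X).

Lemma image_coords c : dom c p -> coords_image c (coords c p).
Proof. by exists p. Qed.

Lemma hessian_sym c : coordinates_at p c ->
  (hessian f c (coords c p))^T = hessian f c (coords c p).
Proof.
move=> [Ac cp]; apply/matrixP => i j; rewrite !mxE.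
apply: (@smooth_partial_comm _ _ (coords_image c)).
- exact: image_open.
- exact: f_smooth.
- exact: image_coords.
Qed.

(** Read off from the metric: in the transformation law a product with factor J is the invertible
    Gram matrix, so J is invertible. *)
Lemma jacobian_unit c d : coordinates_at p c -> coordinates_at p d ->
  'J (transition c d) (coords c p) \in unitmx.
Proof.
move=> [Ac cp] [Ad dp]; have := gram_unit g Ac (image_coords cp).
by rewrite (gram_change g Ac Ad cp dp) !unitmx_mul => /andP[/andP[]].
Qed.

(* With v the difference to be estimated, v G = (df - x H) - x H G^-1 (G(x) - G)
   - v (G(x) - G) where the last term is absorbed by v near 0; this avoids the
   differentiability of the inverse matrix. *)
Lemma gradient_expansion c : coordinates_at p c -> coords c p = 0 ->
  differential f c 0 = 0 ->
  exists C : R, \forall x \near (0 : 'rV[R]_n),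
    `|gradient g f c x - x *m (hessian f c 0 *m invmx (g c 0))| <= C * `|x| ^+ 2.
Proof.
move=> [Ac cp] c0 df0; have im0 : coords_image c 0 by rewrite -c0; exact: image_coords.
have oI : open (coords_image c) by exact: image_open.
set H := hessian f c 0; set G := g c 0.
have Gu : G \in unitmx by exact: gram_unit.
have /choice[C1 C1P] j : exists C : R, 0 < C /\ \forall x \near (0 : 'rV[R]_n),
    `|differential f c x 0 j - (x *m H) 0 j| <= C * `|x| ^+ 2.
  have sj := smooth_on_partial j (f_smooth Ac : smooth_on _ (local_expr f c)).
  have [|i|C C0 CP] := @taylor2 _ _ (partial j (local_expr f c)) 0.
  - exact: (smooth_on_near oI sj im0).
  - by apply: smooth_on_differentiable im0; exact: smooth_on_partial.
  exists C; split=> //; apply: filterS CP => x; rewrite addr0.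
  have -> : partial j (local_expr f c) 0 = 0 by have /rowP/(_ j) := df0; rewrite !mxE.
  rewrite subr0 diff_partial; last exact: smooth_on_differentiable im0.
  rewrite !mxE; congr (`|_ - _| <= _).
  by apply: eq_bigr => i _; rewrite [H i j]mxE.
have /choice[C2 C2P] (ij : 'I_n * 'I_n) : exists C : R, 0 < C /\
    \forall x \near (0 : 'rV[R]_n), `|(g c x - G) ij.1 ij.2| <= C * `|x|.
  have dg := smooth_on_differentiable (gram_smooth g ij.1 ij.2 Ac) im0.
  have [C C0 CP] := differentiable_near_lipschitz dg.
  by exists C; split=> //; apply: filterS CP => x; rewrite addr0 !mxE.
pose D := H *m invmx G.
pose K1 := \sum_j C1 j; pose K2 := \sum_i \sum_j C2 (i, j).
pose K3 := \sum_i \sum_j `|D i j|; pose K4 := \sum_i \sum_j `|invmx G i j|.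
have K1ge0 : 0 <= K1 by rewrite sumr_ge0// => j _; have [/ltW] := C1P j.
have K2ge0 : 0 <= K2.
  rewrite sumr_ge0// => i _; rewrite sumr_ge0// => j _.
  by have [/ltW] := C2P (i, j).
have K3ge0 : 0 <= K3 by do 2!rewrite sumr_ge0// => ? _.
have K4ge0 : 0 <= K4 by do 2!rewrite sumr_ge0// => ? _.
pose C := (K1 + K3 * K2) * K4.
(* For x so small that K2 K4 |x| <= 1/2, the bound reads |v| <= C |x|^2 + |v|/2; solving for |v|
   gives the factor 2. *)
exists (2 * C); near=> x.
have h1 : `|differential f c x - x *m H| <= K1 * `|x| ^+ 2.
  have hj : forall j, `|differential f c x 0 j - (x *m H) 0 j| <= C1 j * `|x| ^+ 2.
    near: x; exact: (@filter_forall _ _ (fun j x =>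
      `|differential f c x 0 j - (x *m H) 0 j| <= C1 j * `|x| ^+ 2) _ _
      (fun j => (C1P j).2)).
  apply: row_norm_le => [|j]; first by rewrite mulr_ge0// sqr_ge0.
  rewrite [X in `|X|]mxE [X in _ + X]mxE (le_trans (hj j))// ler_wpM2r ?sqr_ge0//.
  rewrite /K1 (bigD1 j)//= lerDl sumr_ge0// => i _.
  by have [/ltW] := C1P i.
have h2 (v : 'rV[R]_n) : `|v *m (g c x - G)| <= `|v| * (K2 * `|x|).
  have hij : forall ij, `|(g c x - G) ij.1 ij.2| <= C2 ij * `|x|.
    near: x; exact: (@filter_forall _ _ (fun ij x =>
      `|(g c x - G) ij.1 ij.2| <= C2 ij * `|x|) _ _ (fun j => (C2P j).2)).
  rewrite (le_trans (mulmx_norm_le _ _))// ler_wpM2l//.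
  rewrite /K2 mulr_suml ler_sum// => i _; rewrite mulr_suml ler_sum// => j _.
  exact: (hij (i, j)).
have imx : coords_image c x.
  by near: x; exact: (open_nbhs_nbhs (conj oI im0)).
have gu : g c x \in unitmx by exact: gram_unit.
set v := gradient g f c x - x *m D.
have vG : v *m G = differential f c x - x *m H - x *m D *m (g c x - G) - v *m (g c x - G).
  have vgx : v *m g c x = differential f c x - x *m D *m g c x.
    by rewrite /v mulmxBl /gradient mulmxKV.
  have DG : x *m D *m G = x *m H by rewrite /D !mulmxA mulmxKV.
  by rewrite !mulmxBr vgx DG (opprB (x *m D *m g c x)) addrA subrK subKr.
have xK : K2 * K4 * `|x| <= 1 / 2.
  apply: (@le_trans _ _ ((K2 * K4 + 1) * `|x|)); first by rewrite ler_wpM2r// lerDl.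
  rewrite mulrC -ler_pdivlMr; last by rewrite ltr_wpDl// mulr_ge0.
  near: x; apply: (@nbhs0_le R 'rV[R]_n).
  by rewrite divr_gt0// ltr_wpDl// mulr_ge0.
have : `|v| <= C * `|x| ^+ 2 + `|v| * (1 / 2).
  rewrite -{1}(mulmxK Gu v) (le_trans (mulmx_norm_le _ _))// -/K4 vG.
  have hD : `|x *m D *m (g c x - G)| <= K3 * K2 * `|x| ^+ 2.
    rewrite (le_trans (h2 _))// [leRHS](_ : _ = `|x| * K3 * (K2 * `|x|)); last by ring.
    by rewrite ler_wpM2r ?mulr_ge0// mulmx_norm_le.
  apply: (@le_trans _ _ ((K1 * `|x| ^+ 2 + K3 * K2 * `|x| ^+ 2 + `|v| * (K2 * `|x|)) * K4)).
    rewrite ler_wpM2r// (le_trans (ler_normB _ _))// lerD//.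
    by rewrite (le_trans (ler_normB _ _))// lerD.
  rewrite [leLHS](_ : _ = C * `|x| ^+ 2 + `|v| * (K2 * K4 * `|x|)); last by rewrite /C; ring.
  by rewrite lerD2l ler_wpM2l.
rewrite -/D -/v; lra.
Unshelve. all: by end_near. Qed.
End Gradient.

(** * The linear part of the gradient *)

Section LinearPart.
Context {R : realType} {n : nat} {X : smooth_manifold R n}.
Variables (g : riemannian_metric X) (f : X -> R) (p : X).
Hypothesis f_smooth : smooth_function f.
Implicit Types (c d : chart R n X).

(** On the ray t e_j the hypothesis reads t |M j i| = O(t^2); dividing by t and taking t small
    leaves 0. This makes linear parts unique. *)
Lemma row_linear_bigO_eq0 (M : 'M[R]_n) i :
  (exists C : R, \forall x \near (0 : 'rV[R]_n), `|(x *m M) 0 i| <= C * `|x| ^+ 2) ->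
  forall j, M j i = 0.
Proof.
move=> [C CP] j; apply/eqP; rewrite -normr_le0; apply/ler_addgt0Pr => e e0; rewrite add0r.
have [d /= d0 dP] := (nbhs_ballP _ _).1 CP.
(* The first bound keeps t e_j in the ball, the second makes (|C| + 1) t at most e. *)
pose t := Num.min (d / 2) (e / (`|C| + 1)).
have t0 : 0 < t by rewrite lt_min !divr_gt0// ltr_wpDl.
have nt : `|t *: delta_mx 0 j : 'rV[R]_n| <= t.
  by rewrite normrZ gtr0_norm// ler_piMr ?(ltW t0)// norm_delta_mx_le1.
have tb : ball (0 : 'rV[R]_n) d (t *: delta_mx 0 j).
  rewrite -ball_normE /= sub0r normrN (le_lt_trans nt)//.
  by rewrite gt_min ltr_pdivrMr// ltr_pMr// ltr1n.
have := dP _ tb; rewrite /= -scalemxAl -rowE !mxE normrM gtr0_norm// => h.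
rewrite -(ler_pM2l t0) (le_trans h)//.
apply: (@le_trans _ _ ((`|C| + 1) * t ^+ 2)).
  apply: (@le_trans _ _ (`|C| * `|t *: delta_mx 0 j : 'rV[R]_n| ^+ 2)).
    by rewrite ler_wpM2r ?sqr_ge0// ler_norm.
  by apply: ler_pM; rewrite ?sqr_ge0 ?lerDl// ler_sqr ?nnegrE ?(ltW t0).
rewrite expr2 mulrCA ler_pM2l// mulrC -ler_pdivlMr ?ltr_wpDl//.
by rewrite /t ge_min lexx orbT.
Qed.

(** Turns the analytic condition into a matrix identity: the gradient already has the linear part H
    G^-1 up to O(|x|^2), and two linear parts of the same map coincide. *)
Lemma diagonal_linear_partP c (l : 'I_n -> R) :
  coordinates_at p c -> coords c p = 0 -> differential f c 0 = 0 ->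
  diagonal_linear_part g f p c l <->
  hessian f c 0 *m invmx (g c 0) = diag_mx (\row_i l i).
Proof.
move=> cp c0 df0.
have [C CP] := gradient_expansion g f_smooth cp c0 df0.
set M := _ *m _ in CP *.
have diagE (x : 'rV[R]_n) i : (x *m diag_mx (\row_i l i)) 0 i = l i * x 0 i.
  by rewrite mul_mx_diag !mxE mulrC.
split=> [[_ _ lP]|ME].
- apply/eqP; rewrite -subr_eq0; apply/eqP/matrixP => j i; rewrite [RHS]mxE.
  apply: row_linear_bigO_eq0.
  have /eqaddOP[C' [_ C'P]] := lP i.
  (* The O-notation bounds the remainder for every constant strictly above C'; C' + 1 is one of
     them. *)
  have C'1 : C' < C' + 1 by rewrite ltrDl.
  have {}C'P := C'P _ C'1.
  exists (C + (C' + 1)); near=> x.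
  have h1 : `|gradient g f c x - x *m M| <= C * `|x| ^+ 2 by near: x; exact: CP.
  have h2 : `|gradient g f c x 0 i - l i * x 0 i| <= (C' + 1) * `|x| ^+ 2.
    near: x; apply: filterS C'P => x /=; rewrite !fctE.
    by rewrite [`|_ ^+ 2|]ger0_norm ?sqr_ge0.
  have h3 := le_trans (coord_norm_le _ i) h1.
  rewrite mulmxBr mxE [X in _ + X]mxE diagE mulrDl.
  move: h3; rewrite mxE [X in _ + X]mxE => h3.
  rewrite (le_trans _ (lerD h3 h2))// (le_trans _ (ler_normB _ _))//.
  by rewrite opprB addrCA addrAC subrr add0r distrC.
- split=> // i; apply/eqaddOP; exists C; split; first exact: num_real.
  move=> K /ltW CK; apply: filterS CP => x h.
  rewrite /= !fctE [`|_ ^+ 2|]ger0_norm ?sqr_ge0//.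
  have := coord_norm_le (gradient g f c x - x *m M) i.
  rewrite ME mxE [X in _ + X]mxE diagE => /le_trans; apply.
  by rewrite -ME (le_trans h)// ler_wpM2r ?sqr_ge0.
Unshelve. all: by end_near. Qed.

End LinearPart.

(** * Existence and uniqueness of the diagonal linear part *)

Section Proposition.
Context {R : realType} {n : nat} {X : smooth_manifold R n}.
Variables (g : riemannian_metric X) (f : X -> R) (p : X).
Hypothesis f_morse : morse_function f.
Hypothesis p_crit : critical_point f p.
Implicit Types (c d : chart R n X).

(** Criticality provides one chart only; the transformation law of df carries the vanishing to every
    chart at p. The next lemma does the same for the rank of the Hessian. *)
Lemma critical_differential c : coordinates_at p c -> differential f c (coords c p) = 0.
Proof.
move=> [Ac cp]; have [d [Ad dp] df0] := p_crit.
by rewrite (differential_change f_morse.1 Ac Ad cp dp) df0 mul0mx.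
Qed.

Lemma morse_hessian_rank c : coordinates_at p c -> \rank (hessian f c (coords c p)) = n.
Proof.
move=> [Ac cp]; have [d [Ad dp] dr] := f_morse.2 p p_crit.
rewrite (hessian_change f_morse.1 Ac Ad cp dp); last exact: critical_differential.
have Ju : 'J (transition c d) (coords c p) \in unitmx.
  by apply: (jacobian_unit g); split.
by rewrite mxrankMfree ?row_free_unit ?unitmx_tr// (eqmxMfull _ _) ?row_full_unit.
Qed.

Lemma diagonal_linear_part_exists k : morse_index f p k ->
  exists c (l : 'I_n -> R),
    [/\ diagonal_linear_part g f p c l,
        forall i : 'I_n, (i < k)%N -> l i < 0
      & forall i : 'I_n, (k <= i)%N -> 0 < l i].
Proof.
move=> [c [Ac cp] Hk]; have cpp : coordinates_at p c by [].
set x0 := coords c p in Hk.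
set H := hessian f c x0 in Hk; pose G := g c x0.
have GT : G^T = G by apply: gram_sym => //; exists p.
have Gp : posdef_mx G by move=> v; apply: gram_pos => //; exists p.
have HT : H^T = H by apply: hessian_sym => //; exact: f_morse.1.
have Hr : \rank H = n by exact: morse_hessian_rank.
have [k' [P [d [kn Pu PE dn dge0]]]] := simultaneous_diag GT Gp HT.
have dp (i : 'I_n) : (k' <= i)%N -> 0 < d 0 i.
  by move=> ki; rewrite lt0r (simdiag_neq0 i Pu Hr PE) dge0.
have <- : k' = k.
  by rewrite -Hk (negative_eigenvalues_index GT Gp HT Pu Hr PE kn dn dp).
have Au : invmx P \in unitmx by rewrite unitmx_inv.
(* The new coordinates are (x - x0) P^-1. Tangent vectors are rows and transform by v P^-1, so the
   i-th coordinate vector is the i-th row of P, an eigenvector. *)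
pose c' := affine_chart c (- x0 *m invmx P) Au.
have c'p : coordinates_at p c' by split=> //; exact: affine_chart_atlas.
have c'0 : coords c' p = 0 by rewrite coords_affine_chart mulNmx subrr.
have JE : 'J (transition c c') x0 = invmx P.
  by apply: jacobian_affine_chart; exists p.
clearbody c'; exists c', (d 0); split=> //.
have dc'0 := critical_differential c'p.
have HE := hessian_change f_morse.1 Ac c'p.1 cp c'p.2 dc'0.
have GE := gram_change g Ac c'p.1 cp c'p.2.
rewrite -/x0 JE c'0 -/H in HE; rewrite -/x0 JE c'0 -/G in GE; rewrite c'0 in dc'0.
have PK B : P *m (invmx P *m B *m (invmx P)^T) *m P^T = B.
  by rewrite !mulmxA mulmxV// mul1mx -mulmxA -trmx_mul mulmxV// trmx1 mulmx1.
apply/diagonal_linear_partP => //; first exact: f_morse.1.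
have -> : \row_i d 0 i = d by apply/rowP => i; rewrite mxE.
have g'u : g c' 0 \in unitmx.
  by rewrite -c'0; apply: gram_unit c'p.1 _; exists p => //; exact: c'p.2.
(* With H' = P H P^T and G' = P G P^T in the new chart, P H = D P G gives H' = D G'. *)
by apply: (canLR (mulmxK g'u)); rewrite -[LHS]PK -HE -[g c' 0]PK -GE PE !mulmxA.
Qed.

(** From J D' = D J one gets J i j l' j = l i J i j. Every row of the invertible J has a nonzero
    entry, so each l i equals some l' j; the reverse inclusion follows by exchanging the charts. *)
Lemma diagonal_linear_part_range_sub c c' (l l' : 'I_n -> R) :
  diagonal_linear_part g f p c l -> diagonal_linear_part g f p c' l' ->
  range l `<=` range l'.
Proof.
move=> lP l'P; have [cp c0 _] := lP; have [c'p c'0 _] := l'P.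
have df0 := critical_differential cp; have df'0 := critical_differential c'p.
rewrite c0 in df0; rewrite c'0 in df'0.
move/(diagonal_linear_partP g f_morse.1 l cp c0 df0): lP.
move/(diagonal_linear_partP g f_morse.1 l' c'p c'0 df'0): l'P.
set J := 'J (transition c c') (coords c p).
have Ju : J \in unitmx by exact: (jacobian_unit g).
have HE := hessian_change f_morse.1 cp.1 c'p.1 cp.2 c'p.2 (critical_differential c'p).
have GE := gram_change g cp.1 c'p.1 cp.2 c'p.2.
have gu : g c (coords c p) \in unitmx by apply: gram_unit cp.1 _; exists p => //; exact: cp.2.
have g'u : g c' (coords c' p) \in unitmx.
  by apply: gram_unit c'p.1 _; exists p => //; exact: c'p.2.
rewrite -/J c0 c'0 in HE; rewrite -/J c0 c'0 in GE; rewrite c0 in gu; rewrite c'0 in g'u.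
move=> /(canRL (mulmxKV g'u)) E' /(canRL (mulmxKV gu)) E.
(* Substituting H = D G and H' = D' G' into the congruence of Hessians gives J D' G' J^T = D J G'
   J^T, where G' J^T cancels. *)
have JD : J *m diag_mx (\row_i l' i) = diag_mx (\row_i l i) *m J.
  have JTu : J^T \in unitmx by rewrite unitmx_tr.
  move: E; rewrite HE E' GE !mulmxA.
  by move=> /(can_inj (mulmxK JTu)) /(can_inj (mulmxK g'u)).
move=> _ [i _ <-].
have [j Jij] : exists j, J i j != 0.
  apply/existsP; apply: contraT => /existsPn J0.
  have : delta_mx 0 i *m J = 0 :> 'rV[R]_n.
    by rewrite -rowE; apply/rowP => j; rewrite [LHS]mxE [RHS]mxE; apply/eqP/negPn/J0.
  move/eqP; rewrite mulmx_free_eq0 ?row_free_unit// => /eqP/rowP/(_ i)/eqP.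
  by rewrite !mxE !eqxx oner_eq0.
exists j => //; apply: (mulfI Jij).
have /matrixP/(_ i j) := JD; rewrite mul_mx_diag mul_diag_mx.
by clearbody J; rewrite !mxE => ->; rewrite mulrC.
Qed.
End Proposition.

Theorem proposition2p6 (R : realType) (n : nat) (X : smooth_manifold R n)
    (g : riemannian_metric X) (f : X -> R) (p : X) (k : nat)
    (f_morse : morse_function f) (p_crit : critical_point f p)
    (p_index : morse_index f p k) :
  (exists (c : chart R n X) (l : 'I_n -> R),
     [/\ diagonal_linear_part g f p c l,
         forall i : 'I_n, (i < k)%N -> l i < 0
       & forall i : 'I_n, (k <= i)%N -> 0 < l i]) /\
  (forall (c c' : chart R n X) (l l' : 'I_n -> R),
     diagonal_linear_part g f p c l -> diagonal_linear_part g f p c' l' ->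
     range l = range l').
Proof.
split; first exact: diagonal_linear_part_exists.
move=> c c' l l' lP l'P; apply/seteqP.
by split; apply: (diagonal_linear_part_range_sub f_morse p_crit); eassumption.
Qed.
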